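(* Let $a,b$ be positive integers, let $R=\dfrac{a+\sqrt{a^2+4b}}{2}$, and let $(f[n])_{n\ge 1}$ be defined by $f[1]=f[2]=1$ and $f[n]=a f[n-1]+b f[n-2]$ for $n\ge 3$. For each positive integer $N$ let $\bar{X}=\bar{X}_N$ be a random variable with values in $\{1,\dots,N\}$ and $P(\bar{X}_N=n)=\dfrac{f[n]}{\sum_{k=1}^{N}f[k]}$ for $1\le n\le N$. Then $$\lim_{N\to\infty}\mathrm{Var}(\bar{X}_N)=\frac{R}{(R-1)^2}.$$
   Context: $\mathrm{Var}$ denotes variance. $R$ is the positive real root of the characteristic equation $r^2-ar-b=0$ of the recurrence. *)

(* Defs.v *)
From HB Require Import structures.
From mathcomp Require Import all_boot all_order all_algebra.
From mathcomp Require Import all_classical all_reals all_analysis.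
Set Implicit Arguments.
Unset Strict Implicit.
Unset Printing Implicit Defensive.
Import Order.TTheory GRing.Theory Num.Theory.
Import numFieldNormedType.Exports.
Local Open Scope ring_scope.

(* The positive root of r ^+ 2 - a r - b. *)
Definition charroot {R : realType} (a b : nat) : R :=
  (a%:R + Num.sqrt (a%:R ^+ 2 + 4 * b%:R)) / 2.

(* Main.v *)
(* If [f n ~ c r^n] then [N - X_N] is asymptotically geometric with ratio [1/r],
   whose variance is [r / (r - 1)^2].  The moment sums
   [M_i(N) = \sum_(k <= N) (N - k)^i f k] satisfy [M_0(N+1) = M_0(N) + f (N+1)],
   [M_1(N+1) = M_1(N) + M_0(N)] and [M_2(N+1) = M_2(N) + 2 M_1(N) + M_0(N)];
   after division by [r^N] each of these is an affine recursion of ratio [1/r]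
   with convergent inhomogeneity, which gives the limits of all three. *)
Require Import Defs.
From HB Require Import structures.
From mathcomp Require Import all_boot all_order all_algebra.
From mathcomp Require Import all_classical all_reals all_analysis.
From mathcomp Require Import ring lra.
Set Implicit Arguments.
Unset Strict Implicit.
Unset Printing Implicit Defensive.
Import Order.TTheory GRing.Theory Num.Theory.
Import numFieldNormedType.Exports.
Local Open Scope classical_set_scope.
Local Open Scope ring_scope.

(** The candidate limit is the fixed point of [t = q * t + l]. The error to it is multiplied by [q]
    at each step, up to the perturbation [l - y n], which tends to 0. *)
Lemma cvg_affine_rec (R : realType) (q l : R) (x y : nat -> R) :
  0 <= q < 1 -> (forall n, x n.+1 = q * x n + y n) ->
  y n @[n --> \oo] --> l -> x n @[n --> \oo] --> l / (1 - q).
Proof.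
move=> /andP[q0 q1] xE yl; set L := l / (1 - q).
have q1' : 0 < 1 - q by rewrite subr_gt0.
have LE : L = q * L + l by rewrite /L; field; rewrite gt_eqF.
apply/cvgrPdist_lt => e e0.
(* With this tolerance on [y], the bound [e / 2] reproduces itself:
   [q * (e / 2) + e / 2 * (1 - q) = e / 2]. *)
have d0 : 0 < e / 2 * (1 - q) by rewrite mulr_gt0// divr_gt0.
move/cvgrPdist_lt : yl => /(_ _ d0)[M _ yM].
have bound k : `|L - x (M + k)%N| <= q ^+ k * `|L - x M| + e / 2.
  elim: k => [|k ih]; first by rewrite addn0 expr0 mul1r lerDl divr_ge0// ltW.
  have -> : L - x (M + k.+1)%N = q * (L - x (M + k)%N) + (l - y (M + k)%N).
    by rewrite addnS xE {1}LE; ring.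
  apply: (le_trans (ler_normD _ _)); rewrite normrM (ger0_norm q0) exprS.
  have := ler_wpM2l q0 ih; have /ltW := yM (M + k)%N (leq_addr _ _).
  rewrite /=; lra.
have qn : `|q| < 1 by rewrite ger0_norm.
have qe : q ^+ k * `|L - x M| @[k --> \oo] --> 0.
  by rewrite -(mul0r `|L - x M|); apply: cvgMr_tmp; exact: cvg_expr.
have e20 : 0 < e / 2 by rewrite divr_gt0.
move/cvgrPdist_lt : qe => /(_ _ e20)[K _ qK].
exists (M + K)%N => //= n /= MKn.
have Mn : (M <= n)%N by rewrite (leq_trans _ MKn)// leq_addr.
have := bound (n - M)%N; rewrite subnKC//.
have /= := qK (n - M)%N; rewrite leq_subRL// => /(_ MKn).
rewrite sub0r normrN ger0_norm; last by rewrite mulr_ge0// exprn_ge0.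
lra.
Qed.

(** * Asymptotics of the moments of the distance to [N] *)

Section moments.
Variables (R : realType) (w : nat -> R).

(** Powers are taken of the distance to the top index, so that for [i > 0] the new term [k = N + 1]
    vanishes and the recursions involve lower moments only. *)
Definition moment (i N : nat) : R :=
  \sum_(1 <= k < N.+1) (N%:R - k%:R) ^+ i * w k.

Lemma moment0S N : moment 0 N.+1 = moment 0 N + w N.+1.
Proof.
rewrite /moment big_nat_recr//= expr0 mul1r; congr (_ + _).
Qed.

Lemma moment1S N : moment 1 N.+1 = moment 1 N + moment 0 N.
Proof.
rewrite /moment big_nat_recr//= subrr mul0r addr0 -big_split/=.
by apply: eq_bigr => k _; rewrite -natr1; ring.
Qed.

Lemma moment2S N : moment 2 N.+1 = moment 2 N + (2 * moment 1 N + moment 0 N).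
Proof.
rewrite /moment big_nat_recr//= subrr expr0n mul0r addr0 mulr_sumr -!big_split/=.
by apply: eq_bigr => k _; rewrite -natr1; ring.
Qed.

Variables (r c : R).
Hypotheses (r_gt1 : 1 < r) (c_gt0 : 0 < c).
Hypothesis wc : w n.+1 / r ^+ n @[n --> \oo] --> c.

Let q : R := r^-1.
Let r_gt0 : 0 < r. Proof. exact: lt_trans r_gt1. Qed.
Let r_neq0 : r != 0. Proof. by rewrite gt_eqF. Qed.
Let q01 : 0 <= q < 1.
Proof. by rewrite /q invr_ge0 ltW//= invf_lt1. Qed.

Lemma cvg_moment0 : moment 0 N / r ^+ N @[N --> \oo] --> q * c / (1 - q).
Proof.
(* Dividing the recursion by [r ^+ n.+1] puts a factor [q] on both of its terms. *)
apply: (cvg_affine_rec (y := fun n => q * (w n.+1 / r ^+ n))) => //.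
  move=> n; rewrite moment0S exprS /q; field; by rewrite expf_neq0 r_neq0.
exact: cvgMl_tmp.
Qed.

Lemma cvg_moment1 :
  moment 1 N / r ^+ N @[N --> \oo] --> q * (q * c / (1 - q)) / (1 - q).
Proof.
apply: (cvg_affine_rec (y := fun n => q * (moment 0 n / r ^+ n))) => //.
  move=> n; rewrite moment1S exprS /q; field; by rewrite expf_neq0 r_neq0.
by apply: cvgMl_tmp; exact: cvg_moment0.
Qed.

Lemma cvg_moment2 : moment 2 N / r ^+ N @[N --> \oo] -->
  q * (2 * (q * (q * c / (1 - q)) / (1 - q)) + q * c / (1 - q)) / (1 - q).
Proof.
apply: (cvg_affine_rec
  (y := fun n => q * (2 * (moment 1 n / r ^+ n) + moment 0 n / r ^+ n))) => //.
  move=> n; rewrite moment2S exprS /q; field; by rewrite expf_neq0 r_neq0.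
apply: cvgMl_tmp; apply: cvgD; last exact: cvg_moment0.
by apply: cvgMl_tmp; exact: cvg_moment1.
Qed.

(** Both [r ^+ N] and [c] cancel in the ratios. With [u = q / (1 - q) = 1 / (r - 1)], the normalized
    first and second moments tend to [u] and [2 * u ^+ 2 + u], and
    [u ^+ 2 + u = r / (r - 1) ^+ 2]. *)
Lemma cvg_moment_variance :
  moment 2 N / moment 0 N - (moment 1 N / moment 0 N) ^+ 2 @[N --> \oo]
    --> r / (r - 1) ^+ 2.
Proof.
have q1 : 1 - q != 0 by rewrite gt_eqF// subr_gt0; case/andP: q01.
have r1 : r - 1 != 0 by rewrite gt_eqF// subr_gt0.
have c0 : c != 0 by rewrite gt_eqF.
have m0 : q * c / (1 - q) != 0.
  by rewrite !mulf_neq0 ?invr_eq0// gt_eqF// invr_gt0.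
have cvg_ratio i (l : R) : moment i N / r ^+ N @[N --> \oo] --> l ->
    moment i N / moment 0 N @[N --> \oo] --> l / (q * c / (1 - q)).
  (* This holds for every [N], even when [moment 0 N = 0], because the inverse of 0 is 0. *)
  move=> il; rewrite [X in X @ _ --> _](_ : _ =
    fun N => (moment i N / r ^+ N) / (moment 0 N / r ^+ N)); last first.
    apply/funext => N; rewrite invf_div mulrA divfK//.
    by rewrite expf_eq0 (negbTE r_neq0) andbF.
  by apply: cvgM => //; apply: cvgV => //; exact: cvg_moment0.
have -> : r / (r - 1) ^+ 2 =
    q * (2 * (q * (q * c / (1 - q)) / (1 - q)) + q * c / (1 - q)) / (1 - q)
      / (q * c / (1 - q)) -
    (q * (q * c / (1 - q)) / (1 - q) / (q * c / (1 - q))) ^+ 2.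
  by rewrite /q; field; rewrite c0 r1 r_neq0.
apply: cvgB; first exact/cvg_ratio/cvg_moment2.
by rewrite expr2; apply: cvgM; exact/cvg_ratio/cvg_moment1.
Qed.

End moments.

(** * Growth of the recurrent sequence *)

Section charroot.
Variables (R : realType) (a b : nat).
Hypotheses (a_gt0 : (0 < a)%N) (b_gt0 : (0 < b)%N).
Let r : R := charroot a b.

Lemma charroot_root : r ^+ 2 = a%:R * r + b%:R.
Proof.
have : Num.sqrt (a%:R ^+ 2 + 4 * b%:R) ^+ 2 = a%:R ^+ 2 + 4 * b%:R :> R.
  by rewrite sqr_sqrtr// addr_ge0// ?sqr_ge0// mulr_ge0.
rewrite /r /charroot; set t := Num.sqrt _ => tE.
have -> : b%:R = (t ^+ 2 - a%:R ^+ 2) / 4 :> R by rewrite tE; field.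
by field.
Qed.

Lemma charroot_gt : a%:R < r.
Proof.
have : a%:R < Num.sqrt (a%:R ^+ 2 + 4 * b%:R) :> R.
  rewrite -[ltLHS]ger0_norm// -sqrtr_sqr ltr_sqrt ?ltrDl ?mulr_gt0 ?ltr0n//.
  by rewrite ltr_wpDl ?sqr_ge0// mulr_gt0 ?ltr0n.
rewrite /r /charroot; lra.
Qed.

(* The second characteristic root is [a - r]. *)
Lemma binet (f : nat -> nat) :
  f 1%N = 1%N -> f 2%N = 1%N ->
  (forall n, (3 <= n)%N -> f n = (a * f (n - 1) + b * f (n - 2))%N) ->
  forall n, (f n.+1)%:R * (r - (a%:R - r)) =
    (1 - (a%:R - r)) * r ^+ n - (1 - r) * (a%:R - r) ^+ n.
Proof.
move=> f1 f2 fE n; have rE := charroot_root; move: r rE => x xE.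
(* The recurrence has order two, so the induction carries two consecutive indices. *)
suff [] : (f n.+1)%:R * (x - (a%:R - x)) =
      (1 - (a%:R - x)) * x ^+ n - (1 - x) * (a%:R - x) ^+ n /\
    (f n.+2)%:R * (x - (a%:R - x)) =
      (1 - (a%:R - x)) * x ^+ n.+1 - (1 - x) * (a%:R - x) ^+ n.+1 by [].
elim: n => [|n [ih1 ih2]]; first by rewrite f1 f2; split; ring.
split=> //; rewrite fE// !subSS !subn0 natrD !natrM mulrDl -!mulrA ih1 ih2.
rewrite !exprS; move: (x ^+ n) ((a%:R - x) ^+ n) => u v.
(* Eliminating [b] turns the goal into a polynomial identity. *)
have -> : b%:R = x ^+ 2 - a%:R * x by rewrite xE; ring.
ring.
Qed.

(** After division by [r ^+ n], the Binet formula is a constant minus a multiple of a power of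
    [(a - r) / r]. As [0 < a < r], the modulus [(r - a) / r] is below 1. *)
Lemma cvg_fib_ratio (f : nat -> nat) :
  f 1%N = 1%N -> f 2%N = 1%N ->
  (forall n, (3 <= n)%N -> f n = (a * f (n - 1) + b * f (n - 2))%N) ->
  (f n.+1)%:R / r ^+ n @[n --> \oo] -->
    (1 - (a%:R - r)) / (r - (a%:R - r)).
Proof.
move=> f1 f2 fE; have ra := charroot_gt.
have a1 : 1 <= a%:R :> R by rewrite ler1n.
have r0 : 0 < r by lra.
have rs : r - (a%:R - r) != 0 by rewrite gt_eqF//; lra.
rewrite [X in X @ _ --> _](_ : _ = fun n =>
    (1 - (a%:R - r)) / (r - (a%:R - r)) -
    (1 - r) / (r - (a%:R - r)) * ((a%:R - r) / r) ^+ n); last first.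
  apply/funext => n; rewrite [((a%:R - r) / r) ^+ n]expr_div_n -[X in X / _](mulfK rs) (binet f1 f2 fE).
  by field; rewrite rs expf_eq0 (gt_eqF r0) andbF.
rewrite -[X in _ --> X]subr0; apply: cvgB; first exact: cvg_cst.
rewrite -[X in _ --> X](mulr0 ((1 - r) / (r - (a%:R - r)))).
apply: cvgMl_tmp; apply: cvg_expr.
rewrite normrM normfV (gtr0_norm r0) ltr_pdivrMr// mul1r ltr0_norm; lra.
Qed.

End charroot.

(** * Expectation and variance of a finitely valued variable *)

Section discrete.
Variables (d : measure_display) (T : measurableType d) (R : realType).
Variables (P : probability T R) (X : {RV P >-> R}) (N : nat) (p : nat -> R).
Hypothesis Xval :
  forall t, exists2 n : nat, (1 <= n <= N)%N & X t = n%:R.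
Hypothesis Xlaw : forall n : nat, (1 <= n <= N)%N ->
  P [set t | X t = n%:R] = (p n)%:E.

Lemma expectation_discrete (g : R -> R) :
  'E_P[g \o X]%E = (\sum_(1 <= k < N.+1) g k%:R * p k)%:E.
Proof.
have mX (k : nat) : measurable [set t | X t = k%:R].
  exact: (measurable_funPTI X (measurable_set1 k%:R)).
rewrite unlock.
under eq_integral => t _.
  (* The level sets of [X] for the values 1 to [N] partition the space, so only the term with
     [X t = k] survives. *)
  have -> : ((g \o X) t)%:E = (\sum_(1 <= k < N.+1)
      (g k%:R)%:E * (\1_[set t | X t = k%:R] t)%:E)%E.
    have [n nN Xn] := Xval t.
    rewrite (bigD1_seq n)/= ?mem_index_iota ?iota_uniq ?ltnS//.
    rewrite indicE mem_set//= mule1 Xn big1 ?adde0// => k kn.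
    rewrite indicE memNset/= ?mule0// Xn => /eqP.
    by rewrite eqr_nat eq_sym (negbTE kn).
  over.
rewrite integral_sum//=; last first.
  by move=> k; apply: integrableZl => //; exact: integrable_indic.
rewrite -sumEFin; apply: eq_big_nat => k kN.
rewrite integralZl//; last exact: integrable_indic.
by rewrite integral_indic// setIT EFinM; congr (_ * _)%E; exact: Xlaw.
Qed.

End discrete.

Lemma variance_moment d (T : measurableType d) (R : realType)
    (P : probability T R) (X : {RV P >-> R}) (N : nat) (w : nat -> R) :
  (forall t, exists2 n : nat, (1 <= n <= N)%N & X t = n%:R) ->
  (forall n : nat, (1 <= n <= N)%N ->
    P [set t | X t = n%:R] = (w n / \sum_(1 <= k < N.+1) w k)%:E) ->
  \sum_(1 <= k < N.+1) w k != 0 ->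
  'V_P[X]%E = (moment w 2 N / moment w 0 N
             - (moment w 1 N / moment w 0 N) ^+ 2)%:E.
Proof.
move=> Xval Xlaw w0; pose p n := w n / \sum_(1 <= k < N.+1) w k.
have E g := expectation_discrete (p := p) Xval Xlaw g.
have m0 : \sum_(1 <= k < N.+1) w k = moment w 0 N.
  by apply: eq_bigr => k _; rewrite expr0 mul1r.
have Em i : \sum_(1 <= k < N.+1) (N%:R - k%:R) ^+ i * p k =
    moment w i N / moment w 0 N.
  by rewrite /p m0 /moment [RHS]mulr_suml; apply: eq_bigr => k _; rewrite mulrA.
(* The weights [p] sum to 1, so constants can be moved under the sum. *)
have cp c : \sum_(1 <= k < N.+1) c * p k = c.
  by rewrite -mulr_sumr /p -mulr_suml mulfV// mulr1.
have EX : 'E_P[X]%E = (N%:R - moment w 1 N / moment w 0 N)%:E.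
  rewrite (_ : (X : T -> R) = id \o X)// E -Em; congr EFin.
  rewrite -[X in X - _]cp -sumrB.
  by apply: eq_bigr => k _; rewrite expr1; ring.
rewrite /variance unlock EX/=; set m := moment w 1 N / moment w 0 N in Em EX *.
rewrite (_ : _ * _ = (fun x => (x - (N%:R - m)) ^+ 2) \o X)//.
rewrite E; congr EFin.
(* Since the mean is [N - m], each summand is [((N - k) - m) ^+ 2]; the right side is arranged as
   its term-by-term expansion. *)
have -> : moment w 2 N / moment w 0 N - m ^+ 2 =
  moment w 2 N / moment w 0 N - 2 * m * (moment w 1 N / moment w 0 N) + m ^+ 2.
  by rewrite -/m; ring.
rewrite -[X in _ = _ + X]cp -!Em mulr_sumr -sumrB -big_split/=.
by apply: eq_bigr => k _; ring.
Qed.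

Theorem theorem4p2 (R : realType) (a b : nat) (a_gt0 : (0 < a)%N)
  (b_gt0 : (0 < b)%N) (f : nat -> nat)
  (f1 : f 1%N = 1%N) (f2 : f 2%N = 1%N)
  (fE : forall n : nat, (3 <= n)%N ->
     f n = (a * f (n - 1) + b * f (n - 2))%N)
  (d : nat -> measure_display) (T : forall N : nat, measurableType (d N))
  (P : forall N : nat, probability (T N) R)
  (X : forall N : nat, {RV (P N) >-> R})
  (Xval : forall N : nat, (0 < N)%N -> forall w : T N,
     exists2 n : nat, (1 <= n <= N)%N & X N w = n%:R)
  (Xlaw : forall N n : nat, (1 <= n <= N)%N ->
     P N [set w : T N | X N w = n%:R] =
     ((f n)%:R / \sum_(1 <= k < N.+1) (f k)%:R)%:E) :
  let r : R := charroot a b in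
  'V_(P N)[X N] @[N --> \oo] --> (r / (r - 1) ^+ 2)%:E.
Proof.
move=> r; have ra : a%:R < r := charroot_gt R a b_gt0.
have a1 : 1 <= a%:R :> R by rewrite ler1n.
have c_gt0 : 0 < (1 - (a%:R - r)) / (r - (a%:R - r)) by apply: divr_gt0; lra.
have r1 : 1 < r by lra.
have mv := cvg_moment_variance (w := fun n => (f n)%:R) r1 c_gt0
  (cvg_fib_ratio a_gt0 b_gt0 f1 f2 fE).
have VE N (N0 : (0 < N)%N) := variance_moment (w := fun n => (f n)%:R)
  (Xval N N0) (Xlaw N).
(* The first term [f 1 = 1] already makes the sum positive. *)
have sum_neq0 N : (0 < N)%N -> \sum_(1 <= k < N.+1) (f k)%:R != 0 :> R.
  move=> N0; rewrite gt_eqF// big_nat_recl// f1 ltr_pwDl//.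
  by apply: sumr_ge0 => k _; rewrite ler0n.
(* The variance is an extended real; for [N >= 1] it is finite and equals the moment expression,
   which suffices for the limit. *)
apply: cvg_EFin.
  by exists 1%N => // N /= N0; rewrite VE ?sum_neq0.
apply: cvg_trans mv; apply: near_eq_cvg.
by exists 1%N => // N /= N0; rewrite VE ?sum_neq0.
Qed.
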